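(* Let $n\ge 1$, let $\pi:\widetilde{\mathcal{N}}_1\to\mathcal{N}_1$ be the Springer resolution of the odd nilpotent cone of $\mathfrak{osp}(2n+1,2n)$ and let $\mathcal{O}_1$ be the unique codimension $1$ orbit in $\mathcal{N}_1$. For $X\in\mathcal{O}_1$, the fiber $\pi^{-1}(X)$ is the disjoint union of two points.
   Context: We work over $\mathbb{C}$. Let $V=V_0\oplus V_1$ be a $\mathbb{Z}/2\mathbb{Z}$-graded vector space with $\dim V_0=2n+1$, $\dim V_1=2n$, equipped with a bilinear form $B$ for which $V_0$ and $V_1$ are orthogonal, and whose restrictions $\varphi:V_0\to V_0^\vee$ and $\psi:V_1\to V_1^\vee$ are non-degenerate, respectively symmetric and alternating. For $u\in\mathrm{Hom}(V_0,V_1)$ let $u^*=\varphi^{-1}\circ u^t\circ\psi\in\mathrm{Hom}(V_1,V_0)$. The odd elements of $\mathfrak{osp}(2n+1,2n)$ are the endomorphisms $X=(u,u^* )$ of $V$ (acting as $u$ on $V_0$ and as $u^*$ on $V_1$). The odd nilpotent cone $\mathcal{N}_1$ is the set of those $X=(u,u^* )$ that are nilpotent; the group $G_0\times G_1=\mathrm{O}(V_0,\varphi)\times \mathrm{Sp}(V_1,\psi)$ acts on it by conjugation. Let $B_0,B_1$ be Borel subgroups of $G_0,G_1$; $G_0/B_0$ (resp. $G_1/B_1$) is the variety of complete isotropic flags $(E_i)_{1\le i\le n}$ in $V_0$ (resp. $(F_j)_{1\le j\le n}$ in $V_1$), with $\dim E_i=i$, $\dim F_j=j$; set $E_0=F_0=0$.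 Put $$\widetilde{\mathcal{N}}_1=\{(u,(E_i),(F_j))\in \mathrm{Hom}(V_0,V_1)\times G_0/B_0\times G_1/B_1 : u(E_i)\subset F_{i-1},\ u^*(F_i)\subset E_i \text{ for all } 1\le i\le n\}$$ and let $\pi:\widetilde{\mathcal{N}}_1\to\mathcal{N}_1$ be the first projection; it is a resolution of singularities. Orbits in $\mathcal{N}_1$ are classified by marked Young diagrams: diagrams whose boxes are labelled $0$ or $1$, alternating along each line (row), a line having parity $\epsilon$ if its first label is $\epsilon$; the diagram of $X$ is the one in which, for all $k\ge1$ and $\epsilon\in\{0,1\}$, the number of lines of parity $\epsilon$ and length at least $k$ is $\dim(\ker X\cap \mathrm{Im}\,X^{k-1}\cap V_\epsilon)$. The orbit $\mathcal{O}_1$ has diagram consisting of one line $101\cdots101$ of length $4n-1$ and two lines $0$ of length $1$. *)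

(* Defs.v *)
From HB Require Import structures.
From mathcomp Require Import all_boot all_order all_algebra.
From mathcomp Require Import boolp classical_sets.

Set Implicit Arguments.
Unset Strict Implicit.
Unset Printing Implicit Defensive.

Import GRing.Theory.
Local Open Scope ring_scope.
Local Open Scope classical_set_scope.

Section LinearAlgebra.
Variable F : fieldType.
Local Notation dual V := 'Hom(V, F^o).

Section Transpose.
Variables U W : vectType F.

Definition transpose_fun (u : 'Hom(U, W)) (f : dual W) : dual U := (f \o u)%VF.

Fact transpose_fun_is_linear u : linear (transpose_fun u).
Proof. by move=> k f g; rewrite /transpose_fun comp_lfunDl comp_lfunZl. Qed.
HB.instance Definition _ u :=
  GRing.isLinear.Build F (dual W) (dual U) *:%R (transpose_fun u)
    (transpose_fun_is_linear u).

Definition transpose (u : 'Hom(U, W)) : 'Hom(dual W, dual U) :=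
  linfun (transpose_fun u).

Lemma transposeE u f x : transpose u f x = f (u x).
Proof. by rewrite lfunE /= comp_lfunE. Qed.

End Transpose.

(* A bilinear form b on V is encoded as the linear map x |-> b x _ from V
   to its dual. *)
Section Forms.
Variable V : vectType F.
Implicit Types (b : 'Hom(V, dual V)) (U : {vspace V}).

Definition nondegenerate b : Prop := (lker b == 0)%VS.
Definition symmetric_form b : Prop := forall x y, b x y = b y x.
Definition alternating_form b : Prop := forall x, b x x = 0.

Definition isotropic b U : Prop := {in U &, forall x y, b x y = 0}.

Definition isometries b : set 'End(V) :=
  [set g | (lker g == 0)%VS /\ forall x y, b (g x) (g y) = b x y].

(* The flag E_1, ..., E_n is stored as an n-tuple, so E_i is at index i - 1. *)
Definition flag_space n (E : n.-tuple {vspace V}) (i : nat) : {vspace V} :=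
  nth 0%VS (0%VS :: E) i.

Definition isotropic_flags n b : set (n.-tuple {vspace V}) :=
  [set E | forall i : nat, (1 <= i <= n)%N ->
     [/\ \dim (flag_space E i) = i,
         (flag_space E i.-1 <= flag_space E i)%VS
       & isotropic b (flag_space E i)]].

Definition lfun_exp (X : 'End(V)) (k : nat) : 'End(V) :=
  iter k (comp_lfun X) \1%VF.

Definition nilpotent_endo (X : 'End(V)) : Prop := exists k, lfun_exp X k = 0.

End Forms.

Section Graded.
Variables V0 V1 : vectType F.
Local Notation V := (V0 * V1)%type.

Definition in0_fun (x : V0) : V := (x, 0).
Definition in1_fun (y : V1) : V := (0, y).

Fact in0_fun_is_linear : linear in0_fun.
Proof.
by move=> k x y; apply/eqP; rewrite /eq_op /= scaler0 addr0 !eqxx.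
Qed.
Fact in1_fun_is_linear : linear in1_fun.
Proof.
by move=> k x y; apply/eqP; rewrite /eq_op /= scaler0 addr0 !eqxx.
Qed.
HB.instance Definition _ :=
  GRing.isLinear.Build F V0 V *:%R in0_fun in0_fun_is_linear.
HB.instance Definition _ :=
  GRing.isLinear.Build F V1 V *:%R in1_fun in1_fun_is_linear.

Definition in0 : 'Hom(V0, V) := linfun in0_fun.
Definition in1 : 'Hom(V1, V) := linfun in1_fun.

Lemma in0E x : in0 x = (x, 0). Proof. by rewrite lfunE. Qed.
Lemma in1E y : in1 y = (0, y). Proof. by rewrite lfunE. Qed.

Definition graded_part (eps : bool) : {vspace V} :=
  if eps then limg in1 else limg in0.

Definition endo_of_fun00 (g0 : 'End(V0)) (g1 : 'End(V1)) (v : V) : V :=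
  (g0 v.1, g1 v.2).
Definition endo_of_fun01 (u : 'Hom(V0, V1)) (w : 'Hom(V1, V0)) (v : V) : V :=
  (w v.2, u v.1).

Fact endo_of_fun00_is_linear g0 g1 : linear (endo_of_fun00 g0 g1).
Proof. by move=> k x y; rewrite /endo_of_fun00 /= !linearP. Qed.
Fact endo_of_fun01_is_linear u w : linear (endo_of_fun01 u w).
Proof. by move=> k x y; rewrite /endo_of_fun01 /= !linearP. Qed.
HB.instance Definition _ g0 g1 :=
  GRing.isLinear.Build F V V *:%R (endo_of_fun00 g0 g1)
    (endo_of_fun00_is_linear g0 g1).
HB.instance Definition _ u w :=
  GRing.isLinear.Build F V V *:%R (endo_of_fun01 u w)
    (endo_of_fun01_is_linear u w).

Definition even_endo g0 g1 : 'End(V) := linfun (endo_of_fun00 g0 g1).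
Definition odd_endo u w : 'End(V) := linfun (endo_of_fun01 u w).

Lemma even_endoE g0 g1 v : even_endo g0 g1 v = (g0 v.1, g1 v.2).
Proof. by rewrite lfunE. Qed.
Lemma odd_endoE u w v : odd_endo u w v = (w v.2, u v.1).
Proof. by rewrite lfunE. Qed.

Section OrthoSymplectic.
Variable B : 'Hom(V, dual V).

Definition form0 : 'Hom(V0, dual V0) := (transpose in0 \o B \o in0)%VF.
Definition form1 : 'Hom(V1, dual V1) := (transpose in1 \o B \o in1)%VF.

Lemma form0E x x' : form0 x x' = B (x, 0) (x', 0).
Proof. by rewrite !comp_lfunE transposeE !in0E. Qed.
Lemma form1E y y' : form1 y y' = B (0, y) (0, y').
Proof. by rewrite !comp_lfunE transposeE !in1E. Qed.

Definition orthosymplectic : Prop :=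
  [/\ forall x y, B (x, 0) (0, y) = 0 /\ B (0, y) (x, 0) = 0,
      nondegenerate form0 /\ symmetric_form form0
    & nondegenerate form1 /\ alternating_form form1].

(* For nondegenerate form0 on a finite-dimensional space, the library's
   right inverse form0^-1 is the two-sided inverse. *)
Definition adjoint (u : 'Hom(V0, V1)) : 'Hom(V1, V0) :=
  (form0^-1 \o transpose u \o form1)%VF.

Lemma adjointE u y x :
  orthosymplectic -> form0 (adjoint u y) x = form1 y (u x).
Proof.
case=> _ [nd0 _] _.
have dimD : \dim {: dual V0} = \dim {: V0} by rewrite !dimvf /dim /= muln1.
have im0 : limg form0 = fullv.
  apply/eqP; rewrite eqEdim subvf dimD -(limg_ker_dim form0 fullv).
  by rewrite (eqP nd0) capv0 dimv0 add0n leqnn.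
have -> : adjoint u y = form0^-1%VF (transpose u (form1 y)).
  by rewrite /adjoint 2!comp_lfunE.
by rewrite limg_lfunVK ?im0 ?memvf // transposeE.
Qed.

Definition osp_odd (u : 'Hom(V0, V1)) : 'End(V) := odd_endo u (adjoint u).

Definition odd_nilcone : set 'End(V) :=
  [set X | (exists u, X = osp_odd u) /\ nilpotent_endo X].

Definition nilcone_orbit (X : 'End(V)) : set 'End(V) :=
  [set Y | exists g0 g1, [/\ isometries form0 g0, isometries form1 g1
     & Y = (even_endo g0 g1 \o X \o (even_endo g0 g1)^-1)%VF]].

Definition is_orbit (O : set 'End(V)) : Prop :=
  exists2 X, odd_nilcone X & O = nilcone_orbit X.

Section Springer.
Variable n : nat.

Local Notation triple :=
  ('Hom(V0, V1) * n.-tuple {vspace V0} * n.-tuple {vspace V1})%type.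

Definition springer_variety : set triple :=
  [set t | let: (u, E, G) := t in
     [/\ isotropic_flags form0 E, isotropic_flags form1 G
       & forall i : nat, (1 <= i <= n)%N ->
           (u @: flag_space E i <= flag_space G i.-1)%VS /\
           (adjoint u @: flag_space G i <= flag_space E i)%VS]].

(* The first projection, with u identified to the endomorphism it determines. *)
Definition springer_map (t : triple) : 'End(V) := osp_odd t.1.1.

Definition springer_fiber (X : 'End(V)) : set triple :=
  springer_variety `&` springer_map @^-1` [set X].

End Springer.
End OrthoSymplectic.

(* A diagram is the list of its lines, each line being its list of labels
   (false for 0, true for 1). *)
Definition marked_diagram (D : seq (seq bool)) : Prop :=
  all (fun l => (l != [::]) && sorted (fun a b => a != b) l) D /\
  sorted geq (map size D).

Definition nb_lines (D : seq (seq bool)) (eps : bool) (k : nat) : nat :=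
  count (fun l => (head false l == eps) && (k <= size l)%N) D.

Definition has_diagram (X : 'End(V)) (D : seq (seq bool)) : Prop :=
  marked_diagram D /\
  forall (k : nat) (eps : bool), (1 <= k)%N ->
    nb_lines D eps k =
    \dim (lker X :&: limg (lfun_exp X k.-1) :&: graded_part eps)%VS.

End Graded.
End LinearAlgebra.

Arguments springer_variety {F V0 V1} B n.
Arguments springer_fiber {F V0 V1} B n X.

Definition diagram_O1 (n : nat) : seq (seq bool) :=
  [:: mkseq (fun i => ~~ odd i) (4 * n - 1); [:: false]; [:: false]].

Lemma diagram_O1_marked n : (1 <= n)%N -> marked_diagram (diagram_O1 n).
Proof.
case: n => // n _; rewrite /marked_diagram /diagram_O1 mulnS subn1 /=.
split=> //; rewrite andbT.
suff P m k : path (fun a b : bool => a != b) (~~ odd m)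
   [seq ~~ odd i | i <- iota m.+1 k] by exact: (P 2).
elim: k m => //= k IH m; rewrite (IH m.+1) andbT.
by case: (odd m).
Qed.

(* Main.v *)
(* Write w = u^* and M = u w on V_1.  The diagram says that ker w is a line
   and that ker u is a plane meeting Im w = (ker u)^perp trivially, so that
   the plane ker u is nondegenerate and has exactly two isotropic lines.
   As ker M = ker w, the nilpotent endomorphism M is a single Jordan block.
   For a point of the fiber, M F_i is contained in F_(i-1), which forces
   F_i = ker M^i; moreover E_1 is an isotropic line of ker u, and E_i contains
   the direct sum E_1 + w F_i, of dimension 1 + (i - 1), hence equals it.
   Conversely every isotropic line L of ker u gives the point with
   F_i = ker M^i and E_i = L + w F_i. *)

Require Import Defs.
From mathcomp Require Import all_boot all_order all_algebra.
From mathcomp Require Import boolp classical_sets reals.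
From mathcomp Require Import complex ring zify.

Set Implicit Arguments.
Unset Strict Implicit.
Unset Printing Implicit Defensive.

Import GRing.Theory Num.Theory.
Local Open Scope ring_scope.
Local Open Scope classical_set_scope.
Local Open Scope complex_scope.

(** * Kernels of the powers of a nilpotent endomorphism whose kernel is a line *)

Section Powers.
Variables (F : fieldType) (V : vectType F) (M : 'End(V)).

Lemma lfun_expE k x : lfun_exp M k x = iter k M x.
Proof. by elim: k => [|k IH] /=; rewrite ?id_lfunE // comp_lfunE IH. Qed.

Lemma mem_lker_exp k x : (x \in lker (lfun_exp M k)) = (iter k M x == 0).
Proof. by rewrite memv_ker lfun_expE. Qed.

Lemma lker_exp_mono i j : (i <= j)%N ->
  (lker (lfun_exp M i) <= lker (lfun_exp M j))%VS.
Proof.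
move=> leij; apply/subvP=> x; rewrite !mem_lker_exp -(subnK leij) iterD.
by move=> /eqP->; rewrite -lfun_expE linear0.
Qed.

Lemma limg_lker_exp i :
  (M @: lker (lfun_exp M i.+1) <= lker (lfun_exp M i))%VS.
Proof.
apply/subvP=> _ /memv_imgP[x xK ->].
by move: xK; rewrite !mem_lker_exp iterSr.
Qed.

Hypotheses (nilM : nilpotent_endo M) (dim_kerM : \dim (lker M) = 1%N).

(** Once two consecutive kernels agree, the factors [M] can be stripped one by one from
    [iter (k + i) M x = 0], and nilpotency gives such a relation for every [x]. *)
Lemma lker_exp_fixed i : (lker (lfun_exp M i.+1) <= lker (lfun_exp M i))%VS ->
  lker (lfun_exp M i) = fullv.
Proof.
move=> fixi; apply: subv_anti; rewrite subvf /=; apply/subvP=> x _.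
have fixi_add k : iter (k + i) M x = 0 -> iter i M x = 0.
  elim: k x => [|k IH] y //=; rewrite -iterS iterSr => /IH Miy.
  apply/eqP; rewrite -mem_lker_exp; apply: (subvP fixi).
  by rewrite mem_lker_exp iterSr Miy.
have [N MN] := nilM; rewrite mem_lker_exp; apply/eqP/(@fixi_add N).
by rewrite addnC iterD -(lfun_expE N) MN lfunE -lfun_expE linear0.
Qed.

(** [M] sends ker M^(i+1) into ker M^i with kernel inside a line, so the dimension grows by at most
    one; by [lker_exp_fixed] it cannot stall before the kernel is everything. *)
Lemma dim_lker_exp i : (i <= \dim {:V})%N -> \dim (lker (lfun_exp M i)) = i.
Proof.
elim: i => [_|i IH lti].
  apply/eqP; rewrite dimv_eq0; apply/eqP/vspaceP => x.
  by rewrite mem_lker_exp /= memv0.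
have {}IH := IH (ltnW lti).
apply/eqP; rewrite eqn_leq; apply/andP; split.
  rewrite -(limg_ker_dim M) -[i.+1]add1n leq_add //.
    by rewrite -dim_kerM dimvS ?capvSr.
  by rewrite -[leqRHS]IH dimvS ?limg_lker_exp.
rewrite ltnNge; apply: contraL lti => dim_le; rewrite -leqNgt.
rewrite -[leqRHS]IH lker_exp_fixed // -(geq_leqif (dimv_leqif_sup _)) ?IH //.
exact: lker_exp_mono.
Qed.

(** The power of [M] of exponent dim V is zero, so the image lies in the kernel; rank-nullity makes
    the dimensions equal. *)
Lemma lker_exp_limg i : (i <= \dim {:V})%N ->
  lker (lfun_exp M i) = limg (lfun_exp M (\dim {:V} - i)).
Proof.
move=> lei; apply/esym/eqP; rewrite eqEdim; apply/andP; split.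
  apply/subvP=> _ /memv_imgP[x _ ->].
  rewrite mem_lker_exp lfun_expE -iterD subnKC // -mem_lker_exp.
  suff -> : lker (lfun_exp M (\dim {:V})) = fullv by rewrite memvf.
  by apply/eqP; rewrite eqEdim subvf (dim_lker_exp (leqnn _)) leqnn.
have := limg_ker_dim (lfun_exp M (\dim {:V} - i)) fullv.
rewrite capfv !dim_lker_exp ?leq_subr // => dims; lia.
Qed.

End Powers.

(** * Isotropic lines of a nondegenerate symmetric plane *)

Section IsotropicLines.
Variables (F : numClosedFieldType) (V : vectType F).
Variables (b : 'Hom(V, 'Hom(V, F^o))) (K : {vspace V}).
Hypotheses (symb : Defs.symmetric_form b) (dimK : \dim K = 2).
Hypothesis ndK : forall x, x \in K -> {in K, forall y, b x y = 0} -> x = 0.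

Lemma exists_isotropic : exists e, [/\ e \in K, e != 0 & b e e = 0].
Proof.
set p := vpick K; have Kp : p \in K := memv_pick K.
have p0 : p != 0 by rewrite vpick0 -dimv_eq0 dimK.
have /subvPn[q Kq qp] : ~~ (K <= <[p]>)%VS.
  by apply/negP=> /dimvS; rewrite dimK dim_vline p0.
have [bpp|bpp] := eqVneq (b p p) 0; first by exists p.
(* [t] is a root of b(tp + q, tp + q) = t^2 b(p,p) + 2t b(p,q) + b(q,q). *)
pose t := (sqrtC (b p q ^+ 2 - b p p * b q q) - b p q) / b p p.
exists (t *: p + q); split.
- by rewrite memvD ?memvZ.
- apply: contra qp; rewrite addrC addr_eq0 => /eqP->.
  by rewrite memvN memvZ ?memv_line.
rewrite !linearD !linearZ /= !lfunE /= !lfunE /= (symb q p).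
rewrite /t /GRing.scale /=; have := sqrtCK (b p q ^+ 2 - b p p * b q q).
move: (sqrtC _) => s sE.
have -> : b q q = (b p q ^+ 2 - s ^+ 2) / b p p by rewrite sE; field.
by field.
Qed.

Lemma exists_hyperbolic_basis : exists e f,
  [/\ e \in K, f \in K, b e e = 0, b f f = 0 & b e f = 1].
Proof.
have [e [Ke e0 bee]] := exists_isotropic.
have [q Kq beq] : exists2 q, q \in K & b e q != 0.
  apply: contrapT => noq; case/eqP: e0; apply: ndK => // y Ky.
  by apply: contrapT => /eqP bey; apply: noq; exists y.
have [g Kg beg] : exists2 g, g \in K & b e g = 1.
  exists ((b e q)^-1 *: q); first by rewrite memvZ.
  by rewrite linearZ /= /GRing.scale /= mulVf.
(* As b(e,e) = 0 and b(e,g) = 1, b(g - ce, g - ce) = b(g,g) - 2c, which fixes c, while b(e, g - ce)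
   stays 1. *)
exists e, (g - (b g g / 2) *: e); split=> //.
- by rewrite memvB ?memvZ.
- rewrite !linearB !linearZ /= !lfunE /= !lfunE /= !opp_lfunE.
  by rewrite (symb g e) bee beg /GRing.scale /=; field.
- by rewrite linearB linearZ /= bee beg /GRing.scale /= mulr0 subr0.
Qed.

(** In a hyperbolic basis b(ke + lf, ke + lf) = 2kl, which in characteristic zero vanishes only on
    the two coordinate lines. *)
Lemma isotropic_lines : exists L1 L2 : {vspace V}, L1 <> L2 /\
  forall L, [/\ \dim L = 1%N, (L <= K)%VS & isotropic b L] <->
            L = L1 \/ L = L2.
Proof.
have [e [f [Ke Kf bee bff bef]]] := exists_hyperbolic_basis.
have e0 : e != 0.
  by apply: contra_eq_neq bef => ->; rewrite linear0 lfunE eq_sym oner_eq0.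
have f0 : f != 0.
  by apply: contra_eq_neq bef => ->; rewrite linear0 eq_sym oner_eq0.
have efN : (<[e]> :&: <[f]>)%VS = 0%VS.
  apply/eqP; rewrite -subv0; apply/subvP=> x /memv_capP[/vlineP[k ->]].
  move=> /vlineP[l kl]; rewrite memv0 scaler_eq0; apply/orP; left.
  apply/eqP; transitivity (b (k *: e) f).
    by rewrite linearZ /= lfunE /= bef /GRing.scale /= mulr1.
  by rewrite kl linearZ /= lfunE /= bff scaler0.
have Kef : K = (<[e]> + <[f]>)%VS.
  apply/esym/eqP; rewrite eqEdim subv_add -!memvE Ke Kf dimv_disjoint_sum //.
  by rewrite !dim_vline e0 f0 dimK.
have iso_line x : b x x = 0 -> isotropic b <[x]>.
  move=> bxx _ _ /vlineP[k ->] /vlineP[l ->].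
  by rewrite !linearZ /= lfunE /= bxx !scaler0.
exists <[e]>%VS, <[f]>%VS; split=> [lef|L].
  by have := dim_vline f; rewrite -[<[f]>%VS]capvv -{1}lef efN dimv0 f0.
split=> [[dimL LK isoL]|[]->]; last first.
- by split; rewrite ?dim_vline ?f0 -?memvE //; apply: iso_line.
- by split; rewrite ?dim_vline ?e0 -?memvE //; apply: iso_line.
set v := vpick L; have Lv : v \in L := memv_pick L.
have v0 : v != 0 by rewrite vpick0 -dimv_eq0 dimL.
have line x : v \in <[x]>%VS -> x != 0 -> L = <[x]>%VS.
  move=> vx x0; transitivity <[v]>%VS; first apply/esym.
    by apply/eqP; rewrite eqEdim -memvE Lv dimL dim_vline v0.
  by apply/eqP; rewrite eqEdim -memvE vx !dim_vline v0 x0.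
have := subvP LK v Lv; rewrite Kef => /memv_addP[_ /vlineP[k ->]].
move=> [_ /vlineP[l ->] vE].
have := isoL v v Lv Lv; rewrite vE !linearD !linearZ /= !lfunE /= !lfunE /=.
rewrite (symb f e) bee bff bef /GRing.scale /= !mulr0 !mulr1 add0r addr0.
rewrite mulrC -mulr2n => /eqP; rewrite mulrn_eq0 /= mulf_eq0 => /orP[]/eqP z.
- by left; apply: line; rewrite // vE z scale0r addr0 memvZ ?memv_line.
- by right; apply: line; rewrite // vE z scale0r add0r memvZ ?memv_line.
Qed.

End IsotropicLines.

(** * Flags, and the Springer variety over a fixed [u] *)

Lemma flag_space_mktuple (F : fieldType) (V : vectType F) n
    (f : 'I_n -> {vspace V}) (i : 'I_n) :
  flag_space (mktuple f) i.+1 = f i.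
Proof. exact: nth_mktuple. Qed.

Lemma eq_flag (F : fieldType) (V : vectType F) n (E E' : n.-tuple {vspace V}) :
  (forall i, (1 <= i <= n)%N -> flag_space E i = flag_space E' i) -> E = E'.
Proof.
move=> eqE; apply: val_inj; apply: (@eq_from_nth _ 0%VS).
  by rewrite !size_tuple.
by move=> i; rewrite size_tuple => lti; apply: (eqE i.+1).
Qed.

Section SpringerFiber.
Variables (F : fieldType) (V0 V1 : vectType F).
Variable B : 'Hom((V0 * V1)%type, 'Hom((V0 * V1)%type, F^o)).
Variables (n : nat) (u : 'Hom(V0, V1)).
Local Notation b0 := (form0 B).
Local Notation b1 := (form1 B).
Local Notation w := (adjoint B u).
Local Notation M := (u \o w)%VF.
Local Notation Flag1 i := (lker (lfun_exp M i)).

Arguments form0 : simpl never.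
Arguments form1 : simpl never.
Arguments adjoint : simpl never.

Hypothesis osp : orthosymplectic B.

Lemma form0C : Defs.symmetric_form b0.
Proof. by case: osp => _ []. Qed.

Lemma form1C y y' : b1 y y' = - b1 y' y.
Proof.
case: osp => _ _ [_ alt]; have := alt (y + y').
rewrite !linearD /= !add_lfunE !alt add0r addr0 addrC => /eqP.
by rewrite addr_eq0 => /eqP.
Qed.

Lemma comp_adjointE y : M y = u (w y).
Proof. exact: comp_lfunE. Qed.

Lemma form0_adjoint y x : b0 x (w y) = b1 y (u x).
Proof. by rewrite form0C adjointE. Qed.

(** Both sides equal -b0(w y, w y'): [form0] is symmetric, while [form1] is antisymmetric and
    contributes the sign. *)
Lemma form1_skew y y' : b1 (M y) y' = - b1 y (M y').
Proof. by rewrite form1C !comp_adjointE -!form0_adjoint form0C. Qed.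

Lemma form1_skew_iter k y y' :
  b1 (iter k M y) y' = (-1) ^+ k * b1 y (iter k M y').
Proof.
elim: k y' => [|k IH] y'; first by rewrite mul1r.
by rewrite iterS form1_skew IH -iterSr exprS mulN1r mulNr.
Qed.

Hypotheses (dimV1 : \dim {:V1} = (2 * n)%N) (dimKw : \dim (lker w) = 1%N).
Hypothesis Kuw : (lker u :&: limg w)%VS = 0%VS.
Hypothesis nilM : nilpotent_endo M.

Lemma lker_M : lker M = lker w.
Proof.
apply/vspaceP=> y; rewrite !memv_ker comp_adjointE; apply/eqP/eqP => [uwy|->].
  by apply/eqP; rewrite -memv0 -Kuw memv_cap memv_ker uwy eqxx memv_img ?memvf.
exact: linear0.
Qed.

Lemma dimKM : \dim (lker M) = 1%N. Proof. by rewrite lker_M. Qed.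

Lemma lker_exp1 : Flag1 1 = lker w.
Proof.
by rewrite -lker_M; apply/vspaceP=> y; rewrite mem_lker_exp memv_ker.
Qed.

Lemma dim_Flag1 i : (i <= 2 * n)%N -> \dim (Flag1 i) = i.
Proof. by move=> lei; rewrite (dim_lker_exp nilM dimKM) // dimV1. Qed.

(** Writing y = M^(2n-i) z, skewness moves M^(2n-i) onto y', which it kills because 2n - i >= i. *)
Lemma isotropic_Flag1 i : (i <= n)%N -> isotropic b1 (Flag1 i).
Proof.
move=> lein y y' Ky Ky'; have lei2 : (i <= 2 * n)%N by lia.
move: Ky; rewrite (lker_exp_limg nilM dimKM) ?dimV1 // => /memv_imgP[z _ ->].
rewrite lfun_expE form1_skew_iter.
have -> : iter (2 * n - i) M y' = 0.
  apply/eqP; rewrite -mem_lker_exp; apply: subvP Ky'.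
  by apply: lker_exp_mono; lia.
by rewrite linear0 mulr0.
Qed.

(** The dimensions 2 + (2n - 1) make V_0 the direct sum of ker u and Im w. Adjunction makes these
    orthogonal, so a vector in the radical of ker u is orthogonal to all of V_0. *)
Lemma lker_u_nondegenerate :
  \dim {:V0} = (2 * n + 1)%N -> \dim (lker u) = 2 ->
  forall x, x \in lker u -> {in lker u, forall y, b0 x y = 0} -> x = 0.
Proof.
move=> dimV0 dimKu x; rewrite memv_ker => /eqP ux xK.
have full : (lker u + limg w)%VS = fullv.
  apply/eqP; rewrite eqEdim subvf dimv_disjoint_sum // dimKu dimV0.
  by have := limg_ker_dim w fullv; rewrite capfv dimKw dimV1 => <-; lia.
case: osp => _ [/eqP nd _] _; apply/eqP; rewrite -memv0 -nd memv_ker.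
apply/eqP/lfunP=> y; rewrite zero_lfunE.
have: y \in (lker u + limg w)%VS by rewrite full memvf.
move=> /memv_addP[k Kk [_ /memv_imgP[z _ ->] ->]].
by rewrite linearD /= xK // form0_adjoint ux linear0 addr0.
Qed.

Definition springer_point (L : {vspace V0}) :
    'Hom(V0, V1) * n.-tuple {vspace V0} * n.-tuple {vspace V1} :=
  (u, [tuple (L + w @: Flag1 i.+1)%VS | i < n], [tuple Flag1 i.+1 | i < n]).

(** Index 0 is excluded: there the flag space is 0 by convention, whereas the right side would be
    [L]. *)
Lemma springer_point_E L i : (1 <= i <= n)%N ->
  flag_space (springer_point L).1.2 i = (L + w @: Flag1 i)%VS.
Proof.
by case: i => // i lti; rewrite (flag_space_mktuple _ (Ordinal lti)).
Qed.

Lemma springer_point_G L i : (i <= n)%N ->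
  flag_space (springer_point L).2 i = Flag1 i.
Proof.
case: i => [_|i lti]; last by rewrite (flag_space_mktuple _ (Ordinal lti)).
by apply/esym/eqP; rewrite -dimv_eq0 dim_Flag1.
Qed.

Lemma springer_point_inj : (1 <= n)%N -> injective springer_point.
Proof.
move=> n1 L L' /(congr1 (fun t => flag_space t.1.2 1)).
rewrite !springer_point_E ?n1 // lker_exp1.
(* E_1 is L + w(ker w) = L, so the point determines [L]. *)
suff -> : (w @: lker w = 0)%VS by rewrite !addv0.
by apply/eqP; rewrite -lkerE subvv.
Qed.

Section Point.
Variable L : {vspace V0}.
Hypotheses (LKu : (L <= lker u)%VS) (dimL : \dim L = 1%N).
Hypothesis isoL : isotropic b0 L.

(** [L] lies in ker u and w F_i in Im w, so the sum is direct; F_i contains the line ker w, hence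
    the dimension is 1 + (i - 1). *)
Lemma dim_springer_point_E i : (1 <= i <= n)%N ->
  \dim (L + w @: Flag1 i)%VS = i.
Proof.
move=> /andP[i0 lein]; rewrite dimv_disjoint_sum; last first.
  apply/eqP; rewrite -subv0 -Kuw; apply: capvS => //.
  by rewrite limgS ?subvf.
have := limg_ker_dim w (Flag1 i); rewrite dim_Flag1; last lia.
suff -> : (Flag1 i :&: lker w)%VS = lker w by rewrite dimKw dimL.
by apply/capv_idPr; rewrite -lker_exp1 lker_exp_mono.
Qed.

Lemma isotropic_springer_point_E i : (i <= n)%N ->
  isotropic b0 (L + w @: Flag1 i)%VS.
Proof.
move=> lein x x' /memv_addP[l Ll [_ /memv_imgP[y Fy ->] ->]].
move=> {x x'} /memv_addP[l' Ll' [_ /memv_imgP[y' Fy' ->] ->]].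
have uL x : x \in L -> u x = 0 by move/(subvP LKu); rewrite memv_ker => /eqP.
(* The cross terms vanish since u L = 0, and b0(w y, w y') becomes b1(y', M y), where M y is again
   in F_i. *)
rewrite !linearD /= !add_lfunE isoL // adjointE // !form0_adjoint.
rewrite (uL l) // (uL l') // !linear0 !add0r -comp_adjointE.
apply: (isotropic_Flag1 lein Fy').
rewrite mem_lker_exp -iterSr iterS; move: Fy; rewrite mem_lker_exp => /eqP->.
by rewrite linear0.
Qed.

Lemma springer_point_variety : springer_variety B n (springer_point L).
Proof.
split=> i /[dup] i1n /andP[i0 lein]; rewrite ?(springer_point_E L i1n).
- split; first by rewrite dim_springer_point_E ?i0.
    (* For i = 1 the previous space is E_0 = 0, which [springer_point_E] does not cover. *)
    case: i {i1n} i0 lein => [//|[|i]] _ lein; first exact: sub0v.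
    rewrite [i.+2.-1]/= springer_point_E; last exact: ltnW.
    by rewrite addvS // limgS // lker_exp_mono.
  exact: isotropic_springer_point_E.
- rewrite !(springer_point_G L) //; last first.
    by apply: leq_trans lein; apply: leq_pred.
  split; first by rewrite dim_Flag1 //; lia.
    by rewrite lker_exp_mono ?leq_pred.
  exact: isotropic_Flag1.
- rewrite !(springer_point_G L) //; last first.
    by apply: leq_trans lein; apply: leq_pred.
  split; last exact: addvSr.
  (* [u] kills [L], and u w F_i = M F_i lies in F_(i-1). *)
  rewrite limgD subv_add -limg_comp; apply/andP; split.
    by apply: subv_trans (sub0v _); rewrite subv0 -lkerE.
  by case: i i0 {lein i1n} => // i _; apply: limg_lker_exp.
Qed.

End Point.

Lemma springer_varietyP E G : (1 <= n)%N -> springer_variety B n (u, E, G) <->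
  exists2 L, [/\ \dim L = 1%N, (L <= lker u)%VS & isotropic b0 L] &
             (u, E, G) = springer_point L.
Proof.
move=> n1; split=> [[flagE flagG stab]|[L [dimL LK isoL] ->]]; last first.
  exact: springer_point_variety.
have [dimE1 _ isoE1] := flagE 1%N n1.
exists (flag_space E 1).
  (* [flag_space G 0] is 0, so the condition at index 1 reads u E_1 = 0. *)
  split=> //; rewrite lkerE -subv0.
  by have [+ _] := stab 1%N n1.
(* By induction: [w] sends G_(i+1) into E_(i+1), which [u] sends into G_i = ker M^i; so G_(i+1) lies
   in ker M^(i+1), of the same dimension. *)
have GE i : (i <= n)%N -> flag_space G i = Flag1 i.
  elim: i => [_|i IH lti].
    by apply/esym/eqP; rewrite -dimv_eq0 dim_Flag1.
  have [dimG _ _] := flagG i.+1 lti; have [sE sG] := stab i.+1 lti.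
  apply/eqP; rewrite eqEdim dimG dim_Flag1 ?leqnn ?andbT; last lia.
  apply/subvP=> y Gy; rewrite mem_lker_exp iterSr -mem_lker_exp -IH 1?ltnW //.
  by rewrite comp_adjointE; apply/(subvP sE)/memv_img/(subvP sG)/memv_img.
have subE i j : (1 <= i <= j)%N -> (j <= n)%N ->
    (flag_space E i <= flag_space E j)%VS.
  case/andP=> i0; elim: j => [|j IH]; first by rewrite leqNgt i0.
  rewrite leq_eqVlt => /orP[/eqP->//|lti] ltj.
  by apply: subv_trans (IH lti (ltnW ltj)) _; case: (flagE j.+1 ltj).
suff [eqE eqG] : E = (springer_point (flag_space E 1)).1.2 /\
               G = (springer_point (flag_space E 1)).2.
  exact: (congr2 (fun E' G' => (u, E', G')) eqE eqG).
split; apply: eq_flag => i /[dup] /andP[i0 lein] i1n; last first.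
  by rewrite springer_point_G // GE.
have [dimE _ _] := flagE i i1n; have [_ sG] := stab i i1n.
rewrite springer_point_E //; apply/esym/eqP; rewrite eqEdim.
have [E1K _] := stab 1%N n1.
rewrite dimE dim_springer_point_E ?leqnn //; last by rewrite lkerE -subv0.
by rewrite subv_add subE ?i0 // -GE // sG.
Qed.

End SpringerFiber.

(** * Stability of the odd nilpotent cone under conjugation *)

Section Orbit.
Variables (F : fieldType) (V0 V1 : vectType F).
Variable B : 'Hom((V0 * V1)%type, 'Hom((V0 * V1)%type, F^o)).
Lemma osp_odd_inj : injective (osp_odd B).
Proof.
move=> u u' equ; apply/lfunP=> x.
have := congr1 (fun X : 'End(_) => (X (x, 0)).2) equ.
by rewrite /osp_odd !odd_endoE.
Qed.

Lemma lker_even_endo (g0 : 'End(V0)) (g1 : 'End(V1)) :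
  lker g0 == 0%VS -> lker g1 == 0%VS -> lker (even_endo g0 g1) == 0%VS.
Proof.
move=> /lker0P inj0 /lker0P inj1; apply/lker0P=> -[x y] [x' y'].
by rewrite !even_endoE /= => -[/inj0-> /inj1->].
Qed.

Hypothesis osp : orthosymplectic B.

Lemma nilcone_orbit_odd_nilcone X Y :
  odd_nilcone B X -> nilcone_orbit B X Y -> odd_nilcone B Y.
Proof.
move=> [[u ->] [k nilX]] [g0 [g1 [[k0 iso0] [k1 iso1] ->]]].
have := lker_even_endo k0 k1; set g := even_endo g0 g1 => kg.
split; last first.
  exists k; apply/lfunP=> v; rewrite zero_lfunE lfun_expE.
  have -> : iter k (g \o osp_odd B u \o g^-1)%VF v =
            g (iter k (osp_odd B u) (g^-1%VF v)).
    elim: k {nilX} v => [|k IH] v /=; first by rewrite lker0_lfunVK.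
    by rewrite IH !comp_lfunE lker0_lfunK.
  by rewrite -lfun_expE nilX zero_lfunE linear0.
(* The adjoint of g1 u g0^-1 is g0 u^* g1^-1 because g0 and g1 are isometries; this is checked by
   pairing with an arbitrary [z] under [form0]. *)
exists (g1 \o u \o g0^-1)%VF; rewrite -[RHS](lker0_compfK kg).
congr (_ \o _)%VF; apply/lfunP=> -[x y].
rewrite !comp_lfunE /g /osp_odd !even_endoE !odd_endoE /=.
congr pair; last by rewrite !comp_lfunE lker0_lfunK.
case: osp => _ [/lker0P inj0 _] _; apply: inj0; apply/lfunP=> z.
rewrite adjointE //.
have -> : (g1 \o u \o g0^-1)%VF z = g1 (u (g0^-1%VF z)) by rewrite !comp_lfunE.
by rewrite iso1 -{1}[z](lker0_lfunVK k0) iso0 adjointE.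
Qed.

End Orbit.

(** * Reading kernels off the marked diagram *)

Section Diagram.
Variables (F : fieldType) (V0 V1 : vectType F).
Variables (u : 'Hom(V0, V1)) (w : 'Hom(V1, V0)).
Local Notation X := (odd_endo u w).

Lemma dim_lker_odd_endo0 :
  \dim (lker X :&: graded_part V0 V1 false)%VS = \dim (lker u).
Proof.
have -> : (lker X :&: graded_part V0 V1 false = in0 V0 V1 @: lker u)%VS.
  apply/vspaceP=> v; apply/memv_capP/memv_imgP => [[+ /memv_imgP[x _ vE]]|].
    rewrite vE memv_ker in0E odd_endoE /= linear0 => /eqP[ux0].
    by exists x; rewrite ?memv_ker ?ux0 ?in0E.
  move=> [x]; rewrite memv_ker => /eqP ux0 ->.
  split; last exact: memv_img (memvf _).
  by rewrite memv_ker in0E odd_endoE /= ux0 linear0.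
by apply: limg_dim_eq; apply/eqP; rewrite -subv0; apply/subvP=> x /memv_capP[_];
  rewrite memv_ker in0E memv0 => /eqP[->].
Qed.

Lemma dim_lker_odd_endo1 :
  \dim (lker X :&: graded_part V0 V1 true)%VS = \dim (lker w).
Proof.
have -> : (lker X :&: graded_part V0 V1 true = in1 V0 V1 @: lker w)%VS.
  apply/vspaceP=> v; apply/memv_capP/memv_imgP => [[+ /memv_imgP[y _ vE]]|].
    rewrite vE memv_ker in1E odd_endoE /= linear0 => /eqP[wy0].
    by exists y; rewrite ?memv_ker ?wy0 ?in1E.
  move=> [y]; rewrite memv_ker => /eqP wy0 ->.
  split; last exact: memv_img (memvf _).
  by rewrite memv_ker in1E odd_endoE /= wy0 linear0.
by apply: limg_dim_eq; apply/eqP; rewrite -subv0; apply/subvP=> y /memv_capP[_];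
  rewrite memv_ker in1E memv0 => /eqP[->].
Qed.

(** As (w y, 0) = X(0, y), a vector of ker u in Im w lies in ker X, Im X and V_0 at once; the
    diagram counts this space by its lines of parity 0 and length at least 2. *)
Lemma lker_capv_limg_odd_endo :
  (lker X :&: limg X :&: graded_part V0 V1 false = 0)%VS ->
  (lker u :&: limg w = 0)%VS.
Proof.
move=> cap0; apply/eqP; rewrite -subv0; apply/subvP=> x.
move=> /memv_capP[+ /memv_imgP[y _ xE]]; rewrite {x}xE memv_ker => /eqP uwy.
have : in0 V0 V1 (w y) \in (lker X :&: limg X :&: graded_part V0 V1 false)%VS.
  rewrite !memv_cap memv_img ?memvf // andbT memv_ker in0E odd_endoE /= uwy.
  rewrite linear0 eqxx /=; apply/memv_imgP; exists (0, y); rewrite ?memvf //.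
  by rewrite odd_endoE /= linear0.
by rewrite cap0 !memv0 in0E => /eqP[->].
Qed.

(** X^2 acts on V_1 as u w, hence the doubled exponent [k + k]. *)
Lemma nilpotent_comp_odd_endo : nilpotent_endo X -> nilpotent_endo (u \o w)%VF.
Proof.
move=> [k nilX]; exists k; apply/lfunP=> y; rewrite zero_lfunE lfun_expE.
have : iter (k + k) X (0, y) = 0.
  by rewrite iterD -lfun_expE nilX zero_lfunE.
suff -> : iter (k + k) X (0, y) = (0, iter k (u \o w)%VF y).
  by move=> /(congr1 snd).
elim: k {nilX} => // k IH.
by rewrite addSn addnS !iterS IH !odd_endoE /= !linear0 comp_lfunE.
Qed.

Lemma diagram_O1_dims n : (1 <= n)%N -> has_diagram X (diagram_O1 n) ->
  [/\ \dim (lker u) = 2, \dim (lker w) = 1%N & (lker u :&: limg w = 0)%VS].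
Proof.
case: n => // n _ [_ dimX].
rewrite -dim_lker_odd_endo0 -dim_lker_odd_endo1.
have lfun_exp0 : limg (lfun_exp X 1.-1) = fullv by rewrite /lfun_exp /= lim1g.
have lfun_exp1 : lfun_exp X 2.-1 = X by rewrite /lfun_exp /= comp_lfun1r.
(* The first summand is the long line, of parity 1; the others are the two lines of length 1. The
   values needed at (k, parity) = (1, 0), (1, 1), (2, 0) are 2, 1, 0. *)
have nbE eps k : nb_lines (diagram_O1 n.+1) eps k =
    ((eps && (k <= 4 * n.+1 - 1)) +
     ((~~ eps && (k <= 1)) + (~~ eps && (k <= 1))))%N.
  rewrite /nb_lines /diagram_O1 /= mulnS subn1 /= !size_map size_iota.
  by case: eps; rewrite ?addn0.
have := dimX 1%N false isT; have := dimX 1%N true isT; have := dimX 2 false isT.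
rewrite !nbE lfun_exp0 lfun_exp1 !capvf mulnS subn1 /= => d2 <- <-.
split=> //; apply: lker_capv_limg_odd_endo.
by apply/eqP; rewrite -dimv_eq0 -d2.
Qed.

End Diagram.

(** * The fiber over a point of the orbit *)

Theorem proposition3p1 (R : realType) (n : nat) (V0 V1 : vectType R[i])
    (B : 'Hom((V0 * V1)%type, 'Hom((V0 * V1)%type, (R[i])^o)))
    (O1 : set 'End((V0 * V1)%type)) (X : 'End((V0 * V1)%type)) :
  (1 <= n)%N ->
  \dim {:V0} = (2 * n + 1)%N ->
  \dim {:V1} = (2 * n)%N ->
  orthosymplectic B ->
  is_orbit B O1 ->
  (forall Y, O1 Y -> has_diagram Y (diagram_O1 n)) ->
  O1 X ->
  exists p q, p <> q /\ springer_fiber B n X = [set p; q].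
Proof.
move=> n1 dimV0 dimV1 osp [X0 nilX0 ->] diagO orbX.
have := diagO X orbX.
have [[u ->] nilX] := nilcone_orbit_odd_nilcone osp nilX0 orbX.
move=> /(diagram_O1_dims n1)[dimKu dimKw Kuw].
have nilM := nilpotent_comp_odd_endo nilX.
have ndK := lker_u_nondegenerate osp dimV1 dimKw Kuw dimV0 dimKu.
have [L1 [L2 [neqL linesP]]] := isotropic_lines (form0C osp) dimKu ndK.
exists (springer_point B n u L1), (springer_point B n u L2); split.
  by move=> /(springer_point_inj Kuw n1).
have varP := fun E G => springer_varietyP osp dimV1 dimKw Kuw nilM E G n1.
(* Injectivity of [osp_odd] forces the first component of every point of the fiber to be [u]. *)
apply/seteqP; split=> [[[v E] G] [varE /osp_odd_inj /= vu]|t].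
  move: varE; rewrite vu => /varP[L /linesP lineL ->].
  by case: lineL => ->; [left|right].
move=> tL.
have [L lineL tE] :
    exists2 L, L = L1 \/ L = L2 & t = springer_point B n u L.
  by case: tL => ->; [exists L1; [left|]|exists L2; [right|]].
split; last by rewrite tE.
have /linesP[dimL LK isoL] := lineL.
by rewrite tE; apply/varP; exists L.
Qed.
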